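(* Let $F_0\subset\mathbb{R}^n$ be a qFW-set and let $f_1,\dots,f_m:\mathbb{R}^n\to\mathbb{R}$ be polynomials which are convex on $F_0$, such that the set $F=\{x\in F_0: f_i(x)\le 0,\ i=1,\dots,m\}$ is nonempty. Let $f:\mathbb{R}^n\to\mathbb{R}$ be a polynomial which is bounded below on $F$ and has at least one nonempty convex sub-level set on $F$. Then $f$ attains its infimum on $F$.
   Context: A function $f:\mathbb{R}^n\to\mathbb{R}$ is quadratic if $f(x)=\frac12x^{T}Ax+b^{T}x+c$ with $A=A^{T}\in\mathbb{R}^{n\times n}$, $b\in\mathbb{R}^n$, $c\in\mathbb{R}$. A sub-level set of $f$ on $F$ is a set $\{x\in F:f(x)\le\alpha\}$ with $\alpha\in\mathbb{R}$. A function is quasi-convex on a convex set if all its sub-level sets on that set are convex, and convex on a convex set if its restriction to that set is a convex function. A convex set $F_0\subset\mathbb{R}^n$ is a qFW-set (quasi-Frank-and-Wolfe set) if every quadratic function which is quasi-convex on $F_0$ and bounded below on $F_0$ attains its infimum on $F_0$. *)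

(* Defs.v *)
From HB Require Import structures.
From mathcomp Require Import all_boot all_order all_algebra.
From mathcomp Require Import boolp classical_sets reals constructive_ereal ereal convex.
(* Not imported: the notations of mpoly clash with those of MathComp-Analysis. *)
From mathcomp Require mpoly.

Set Implicit Arguments.
Unset Strict Implicit.
Unset Printing Implicit Defensive.

Import Order.TTheory GRing.Theory Num.Theory.

Local Open Scope classical_set_scope.
Local Open Scope ring_scope.

Definition quadratic (R : realType) (n : nat) (f : 'cV[R]_n -> R) : Prop :=
  exists (A : 'M[R]_n) (b : 'cV[R]_n) (c : R),
    A^T = A /\
    forall x, f x = 2^-1 * (x^T *m A *m x) 0 0 + (b^T *m x) 0 0 + c.

Definition polynomial_fun (R : realType) (n : nat) (f : 'cV[R]_n -> R) : Prop :=
  exists p : mpoly.mpoly n R, forall x, f x = mpoly.meval (fun i => x i 0) p.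

Definition sublevel (R : realType) (n : nat) (f : 'cV[R]_n -> R)
    (F : set 'cV[R]_n) (alpha : R) : set 'cV[R]_n :=
  [set x | F x /\ f x <= alpha].

Definition quasi_convex_on (R : realType) (n : nat) (F : set 'cV[R]_n)
    (f : 'cV[R]_n -> R) : Prop :=
  forall alpha : R, @convex_set R 'cV[R]_n (sublevel f F alpha).

Definition bounded_below_on (R : realType) (n : nat) (F : set 'cV[R]_n)
    (f : 'cV[R]_n -> R) : Prop :=
  has_lbound (f @` F).

(* The infimum is taken in \bar R, so that no junk value arises when F is empty
   or f is unbounded below on F. *)
Definition attains_inf_on (R : realType) (n : nat) (F : set 'cV[R]_n)
    (f : 'cV[R]_n -> R) : Prop :=
  exists2 x, F x & (f x)%:E = ereal_inf [set (f y)%:E | y in F].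

Definition qFW_set (R : realType) (n : nat) (F : set 'cV[R]_n) : Prop :=
  @convex_set R 'cV[R]_n F /\
  forall q : 'cV[R]_n -> R, quadratic q -> quasi_convex_on F q ->
    bounded_below_on F q -> attains_inf_on F q.

Definition constrained (R : realType) (n m : nat) (F0 : set 'cV[R]_n)
    (g : 'I_m -> 'cV[R]_n -> R) : set 'cV[R]_n :=
  [set x | F0 x /\ forall i, g i x <= 0].

(* Main.v *)
Require Import Defs.
From mathcomp Require Import all_boot all_order all_algebra.
From mathcomp Require Import boolp classical_sets reals constructive_ereal ereal convex.
From mathcomp Require Import functions interval_inference topology normedtype realfun derive.
From mathcomp Require Import ring lra.
From mathcomp Require polyrcf mpoly.

Import Order.TTheory GRing.Theory Num.Theory.
Import numFieldNormedType.Exports.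

Set Implicit Arguments.
Unset Strict Implicit.
Unset Printing Implicit Defensive.

Local Open Scope classical_set_scope.
Local Open Scope ring_scope.

(** The idea is to minimise [f] on the nonempty convex sub-level set
[S = {x in F0 | g_i x <= 0, f x <= alpha}] by removing its directions of
recession one at a time.

If [S] is bounded it is compact and there is nothing to do.  Otherwise [S] has a
direction of recession [d != 0].  Along [d] the polynomial [f] is bounded on [S]
(below by hypothesis, above by [alpha]), hence constant; since a polynomial that
vanishes on a convex set vanishes on its affine hull, [f] is invariant under [d]
on the whole affine hull [L] of [S].  A convex polynomial [g_i] that is bounded
above along one half-line of direction [d] in a closed convex set is affine along
all of them, with a common slope [c_i <= 0] ([convex_common_slope]).  So project
orthogonally to [d]: the image of [S] is cut out of the image of [F0 /\ L] by [f]
and by those [g_i] with [c_i = 0] only, because a constraint with [c_i < 0] is met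
far enough along [d].  On [F0 /\ L], [f] and the remaining [g_i] take the same
value at a point and at its projection, and the affine hull of the image has
smaller dimension; induction concludes ([feasible_attains_min]).

The projected set must again be closed, and this is where the hypothesis on [F0]
enters: minimising the convex quadratic [x |-> |A x - y|^2] shows that every linear
image of a qFW-set is closed ([qFW_closed_images]).  This property, unlike the
qFW property itself, visibly passes to linear images and to intersections with
affine subspaces, so it is the one carried through the induction.

Polynomials are used only through their continuity and through their restrictions
to lines, which are polynomials in one variable; this class needs no change of
variables when passing to a projection. *)

(** * Polynomials in one variable *)

(** A polynomial of degree above [k] outgrows [K t^k]: according to the sign of its
leading coefficient, subtracting [K t^k] from [p] or from [-p] leaves a
polynomial that is eventually positive. *)
Lemma size_poly_growth (R : realType) (p : {poly R}) (K : R) (k : nat) :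
  (forall t, 1 <= t -> `|p.[t]| <= K * t ^+ k) -> (size p <= k.+1)%N.
Proof.
move=> pK; rewrite leqNgt; apply/negP => kp.
have p0 : p != 0 by apply: contraTneq kp => ->; rewrite size_poly0.
wlog lp : p pK kp p0 / 0 < lead_coef p.
  move=> H; have [|l|l] := ltgtP 0 (lead_coef p); first exact: (H p).
    apply: (H (- p)); rewrite ?size_polyN ?oppr_eq0 ?lead_coefN ?oppr_gt0//.
    by move=> t /pK; rewrite hornerN normrN.
  by move: p0; rewrite -lead_coef_eq0 -l eqxx.
pose q := p - K *: 'X^k.
have szK : (size (- (K *: 'X^k) : {poly R}) < size p)%N.
  by rewrite size_polyN (leq_ltn_trans (size_scale_leq _ _))// size_polyXn.
have lq : lead_coef q = lead_coef p by rewrite lead_coefDl.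
have [|N qN] := @polyrcf.poly_pinfty_gt_lc R q; first by rewrite lq.
have := qN (Num.max 1 N); rewrite le_max lexx orbT => /(_ isT).
rewrite lq !hornerE => q1.
have := pK (Num.max 1 N); rewrite le_max lexx => /(_ isT) p1.
have := ler_norm p.[Num.max 1 N]; lra.
Qed.

(** A limit at [0] in algebraic form: convexity inequalities along a segment are
available only for positive parameters. *)
Lemma horner_ge0_at0 (R : realType) (p : {poly R}) :
  (forall e, 0 < e -> e <= 1 -> 0 <= p.[e]) -> 0 <= p.[0].
Proof.
elim/poly_ind: p => [|q c _] pge0; first by rewrite horner0.
rewrite !hornerE leNgt; apply/negP => c0.
have [M qM] : exists M : R, forall x : R, `|x| <= 1 -> `|q.[x]| <= M.
  by have [M qM] := poly_disk_bound q 1; exists M.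
have M0 : 0 <= M by apply: le_trans (qM 0 _); rewrite ?normr0.
have [e [e0 e1 Me]] : exists e : R, [/\ 0 < e, e <= 1 & M * e < - c].
  have D0 : 0 < M + 1 - c by lra.
  exists (- c / (M + 1 - c)); split; first by rewrite divr_gt0 ?oppr_gt0.
    by rewrite ler_pdivrMr// mul1r; lra.
  by rewrite mulrA ltr_pdivrMr//; nra.
have := pge0 e e0 e1; rewrite !hornerE.
have := qM e; rewrite gtr0_norm// => /(_ e1) qe.
have : q.[e] * e <= M * e by rewrite ler_pM2r// (le_trans (ler_norm _)).
lra.
Qed.

Lemma horner_eq0_itv (R : realType) (p : {poly R}) (r : R) : 0 < r ->
  (forall t, 0 < t -> t <= r -> p.[t] = 0) -> p = 0.
Proof.
move=> r0 p0.
apply: (@roots_geq_poly_eq0 _ p [seq r / i.+1%:R | i <- iota 0 (size p)]).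
- apply/allP => _ /mapP[i _ ->]; apply/rootP/p0; first by rewrite divr_gt0.
  by rewrite ler_pdivrMr// ler_peMr ?ler1n// ltW.
- rewrite map_inj_uniq ?iota_uniq// => i j /(mulfI (lt0r_neq0 r0)) /invr_inj.
  by move=> /eqP; rewrite eqr_nat => /eqP[].
- by rewrite size_map size_iota.
Qed.

Lemma horner_const_of_bounded (R : realType) (p : {poly R}) (K : R) :
  (forall t, 0 <= t -> `|p.[t]| <= K) -> forall t, p.[t] = p.[0].
Proof.
move=> pK t; suff /size1_polyC -> : (size p <= 1)%N by rewrite !hornerC.
apply: (@size_poly_growth _ _ K) => u u1; rewrite expr0 mulr1 pK//.
exact: le_trans u1.
Qed.

(** Convexity bounds [p] below by an affine function (the chord from [0] to [1],
extended) and the hypothesis bounds it above, so the degree is at most one. *)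
Lemma convex_poly_affine (R : realType) (p : {poly R}) (M : R) :
  (forall t, 0 <= t -> p.[t] <= M) ->
  (forall t, 1 <= t -> t * (p.[1] - p.[0]) <= p.[t] - p.[0]) ->
  exists2 c, c <= 0 & forall t, p.[t] = p.[0] + c * t.
Proof.
move=> pM pcvx.
have growth (a b v t : R) : 1 <= t -> t * a <= v - b -> v <= M ->
    `|v| <= (`|M| + `|b| + `|a|) * t.
  move=> t1 h1 h2.
  have Na : - `|a| <= a by rewrite lerNnormlW.
  have Nb : - `|b| <= b by rewrite lerNnormlW.
  have NM := ler_norm M.
  have M0 := normr_ge0 M; have b0 := normr_ge0 b; have a0 := normr_ge0 a.
  have tb : 0 <= (t - 1) * `|b| by rewrite mulr_ge0// subr_ge0.
  have tM : 0 <= (t - 1) * `|M| by rewrite mulr_ge0// subr_ge0.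
  have ta : 0 <= t * (a + `|a|) by apply: mulr_ge0; lra.
  have ta' : 0 <= t * `|a| by apply: mulr_ge0; lra.
  have tb' : 0 <= t * `|b| by apply: mulr_ge0; lra.
  by rewrite ler_norml; apply/andP; split; lra.
have sz2 : (size p <= 2)%N.
  apply: (@size_poly_growth _ _ (`|M| + `|p.[0]| + `|p.[1] - p.[0]|)) => t t1.
  rewrite expr1; apply: growth => //; first exact: pcvx.
  by apply: pM; apply: le_trans t1.
have pE t : p.[t] = p.[0] + p`_1 * t.
  rewrite !(horner_coef_wide _ sz2) !big_ord_recr !big_ord0 /=.
  by rewrite !expr0 !expr1 mulr0 addr0.
exists p`_1 => //; rewrite leNgt; apply/negP => c0.
pose t := (`|M| + `|p.[0]| + 1) / p`_1.
have t0 : 0 <= t by rewrite divr_ge0 ?ltW// !addr_ge0.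
have := pM t t0; rewrite pE /t mulrC divfK ?gt_eqF//.
have := ler_norm M; have : - `|p.[0]| <= p.[0] by rewrite lerNnormlW.
lra.
Qed.

(** * Polynomial functions and convexity in coordinates *)

(** Weaker than being polynomial, but stable under translation and subtraction
with no computation in several variables. *)
Definition poly_on_lines (R : realType) (n : nat) (F : 'cV[R]_n -> R) : Prop :=
  forall x d, exists p : {poly R}, forall t, F (x + t *: d) = p.[t].

Lemma polynomial_fun_lines (R : realType) (n : nat) (f : 'cV[R]_n -> R) :
  polynomial_fun f -> poly_on_lines f.
Proof.
move=> [p fp] x d.
exists (\sum_(k <- mpoly.msupp p) (mpoly.mcoeff k p)%:P *
  \prod_i ((x i 0)%:P + (d i 0)%:P * 'X) ^+ mpoly.fun_of_multinom k i) => t.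
rewrite fp mpoly.mevalE horner_sum; apply: eq_bigr => k _.
rewrite hornerM hornerC horner_prod; congr (_ * _); apply: eq_bigr => i _.
by rewrite horner_exp !hornerE !mxE mulrC.
Qed.

Lemma polynomial_fun_continuous (R : realType) (n : nat) (f : 'cV[R]_n -> R) :
  polynomial_fun f -> continuous f.
Proof.
move=> [p fp]; have -> : f = (fun x => \sum_(k <- mpoly.msupp p)
    mpoly.mcoeff k p * \prod_i x i 0 ^+ mpoly.fun_of_multinom k i).
  by apply/funext => x; rewrite fp mpoly.mevalE.
have cprod k : continuous (fun x : 'cV[R]_n =>
    \prod_i x i 0 ^+ mpoly.fun_of_multinom k i).
  refine (@continuous_big _ _ ( *%R : R -> R -> R) 1 xpredT _ _ _ _ _).
    exact: (@mul_continuous R).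
  move=> i _ x; apply: (cvg_comp (fun y : 'cV[R]_n => y i 0) (fun z => z ^+ _)).
    exact: coord_continuous.
  exact: exprn_continuous.
refine (@continuous_big _ _ (+%R : R -> R -> R) 0 xpredT _ _ _ _ _) => [|k _ x].
  exact: (@pseudometric_normed_Zmodule.add_continuous R R^o).
exact: (cvg_comp _ ( *%R _) (cprod k x) (@mulrl_continuous _ _ _)).
Qed.

Lemma convex_setE (R : realType) (n : nat) (S : set 'cV[R]_n) :
  @convex_set R 'cV[R]_n S <->
  forall x y t, S x -> S y -> 0 <= t -> t <= 1 -> S (x + t *: (y - x)).
Proof.
have lineE (x y : 'cV[R]_n) (t : {i01 R}) :
    @conv R (convex_lmodType 'cV[R]_n) t y x = x + t%:num *: (y - x).
  by rewrite /conv/= scalerBr scalerBl scale1r addrCA addrC.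
split=> cS x y t.
  move=> Sx Sy t0 t1; have := cS y x (Itv01 t0 t1).
  by rewrite !inE => /(_ Sy Sx); rewrite lineE.
by rewrite !inE lineE => Sx Sy; apply: cS.
Qed.

Lemma convex_functionE (R : realType) (n : nat) (C : set 'cV[R]_n)
    (g : 'cV[R]_n -> R) :
  @convex_function R 'cV[R]_n C g <->
  forall x y t, C x -> C y -> 0 <= t -> t <= 1 ->
    g (x + t *: (y - x)) <= g x + t * (g y - g x).
Proof.
have lineE (x y : 'cV[R]_n) (t : {i01 R}) :
    @conv R (convex_lmodType 'cV[R]_n) t y x = x + t%:num *: (y - x).
  by rewrite /conv/= scalerBr scalerBl scale1r addrCA addrC.
have lineRE (x y : R^o) (t : {i01 R}) :
    @conv R R^o t y x = x + t%:num * (y - x).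
  by rewrite -[LHS]/(t%:num * y + (1 - t%:num) * x); ring.
split=> cg.
  move=> x y t Cx Cy t0 t1; have := cg (Itv01 t0 t1) y x.
  by rewrite !inE => /(_ Cy Cx); rewrite lineE lineRE.
move=> t x y; rewrite !inE => Cx Cy; rewrite lineE lineRE; exact: cg.
Qed.

(** * Sets whose linear images are closed *)

Definition closed_images (R : realType) (n : nat) (C : set 'cV[R]_n) : Prop :=
  forall (m : nat) (A : 'M[R]_(m, n)), closed [set A *m x | x in C].

Lemma sqnormE (R : realType) (n : nat) (v : 'cV[R]_n) :
  (v^T *m v) 0 0 = \sum_i (v i 0) ^+ 2.
Proof. by rewrite mxE; apply: eq_bigr => i _; rewrite mxE expr2. Qed.

Lemma sqnorm_eq0 (R : realType) (n : nat) (v : 'cV[R]_n) :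
  (v^T *m v) 0 0 = 0 -> v = 0.
Proof.
rewrite sqnormE => /eqP; rewrite psumr_eq0 => [/allP v0|i _]; last exact: sqr_ge0.
apply/colP => i; rewrite mxE; apply/eqP.
by rewrite -sqrf_eq0; apply: v0; rewrite mem_index_enum.
Qed.

Lemma sqnorm_continuous (R : realType) (n : nat) (y : 'cV[R]_n) :
  continuous (fun z : 'cV[R]_n => \sum_i ((z - y) i 0) ^+ 2).
Proof.
refine (@continuous_big _ _ (+%R : R -> R -> R) 0 xpredT _ _ _ _ _) => [|i _ z].
  exact: (@pseudometric_normed_Zmodule.add_continuous R R^o).
have cB : continuous (fun z : 'cV[R]_n => z - y).
  move=> u.
  have cy : {for u, continuous (fun _ : 'cV[R]_n => y)} by exact: cst_continuous.
  exact: (@continuousB R _ _ id (fun=> y) u cvg_id cy).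
have cw := cvg_comp _ (fun w : 'cV[R]_n => w i 0) (cB z) (@coord_continuous _ _ _ i 0 _).
exact: (cvg_comp _ (fun u => u ^+ 2) cw (@exprn_continuous _ _ _)).
Qed.

(** If [y] is a limit of points [A x] with [x] in [C], the convex quadratic
[x |-> |A x - y|^2] has infimum [0] on [C]; that it is attained says that [y] is
one of these points. *)
Lemma qFW_closed_images (R : realType) (n : nat) (C : set 'cV[R]_n) :
  qFW_set C -> closed_images C.
Proof.
move=> [cC qFW] m A y clAy.
pose q (x : 'cV[R]_n) := \sum_i ((A *m x - y) i 0) ^+ 2.
have q_ge0 x : 0 <= q x by apply: sumr_ge0 => i _; exact: sqr_ge0.
have qcvx x z t : 0 <= t -> t <= 1 ->
    q (x + t *: (z - x)) <= (1 - t) * q x + t * q z.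
  move=> t0 t1; rewrite /q !mulr_sumr -big_split; apply: ler_sum => i _ /=.
  have -> : (A *m (x + t *: (z - x)) - y) i 0 =
      (1 - t) * (A *m x - y) i 0 + t * (A *m z - y) i 0.
    by rewrite mulmxDr -scalemxAr mulmxBr !mxE; ring.
  move: ((A *m x - y) i 0) ((A *m z - y) i 0) => u v.
  have : 0 <= t * (1 - t) * (u - v) ^+ 2.
    by apply: mulr_ge0 (sqr_ge0 _); apply: mulr_ge0; rewrite ?subr_ge0.
  nra.
have quadq : quadratic q.
  exists (2 *: (A^T *m A)), (- (2 *: (A^T *m y))), ((y^T *m y) 0 0); split.
    by rewrite linearZ /= trmx_mul trmxK.
  move=> x; rewrite /q -sqnormE [(_ - _)^T]linearB /= mulmxBl !mulmxBr trmx_mul.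
  rewrite [(- _)^T]linearN /= [(_ *: _)^T]linearZ /= trmx_mul trmxK.
  have xy : x^T *m A^T *m y = (y^T *m (A *m x))^T by rewrite !trmx_mul trmxK.
  rewrite xy mulmxA -scalemxAr !mulNmx -!scalemxAl !mulmxA.
  by rewrite !mxE; field.
have qcq : quasi_convex_on C q.
  move=> a; apply/convex_setE => x z t [Cx qx] [Cz qz] t0 t1; split.
    by have /convex_setE := cC; apply.
  by apply: le_trans (qcvx _ _ _ t0 t1) _; nra.
have qbd : bounded_below_on C q by exists 0 => _ [x _ <-].
have [x0 Cx0 q0] := qFW q quadq qcq qbd.
have q_small e : 0 < e -> q x0 < e.
  move=> e0.
  have : nbhs y [set z : 'cV[R]_m | \sum_i ((z - y) i 0) ^+ 2 < e].
    apply: (@sqnorm_continuous R m y y [set r | r < e]).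
    apply: open_nbhs_nbhs; split; first exact: open_lt.
    by rewrite /= subrr big1 // => i _; rewrite mxE expr0n.
  move=> /clAy [_ [[x Cx <-] /= qx]].
  apply: le_lt_trans qx; rewrite -lee_fin q0; apply: ereal_inf_lbound.
  by exists x.
exists x0 => //; apply/eqP; rewrite -subr_eq0; apply/eqP/sqnorm_eq0.
rewrite sqnormE; apply/eqP; rewrite eq_le q_ge0 andbT leNgt; apply/negP.
by move=> /q_small; rewrite ltxx.
Qed.

Lemma closed_images_image (R : realType) (n m : nat) (A : 'M[R]_(m, n))
    (C : set 'cV[R]_n) : closed_images C -> closed_images [set A *m x | x in C].
Proof.
move=> hC k B; have := hC k (B *m A); congr (closed _).
apply/seteqP; split=> [_ [x Cx <-]|_ [_ [x Cx <-] <-]].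
  by exists (A *m x); [exists x|rewrite mulmxA].
by exists x; rewrite ?mulmxA.
Qed.

Lemma closed_images_closed (R : realType) (n : nat) (C : set 'cV[R]_n) :
  closed_images C -> closed C.
Proof.
move=> /(_ n 1%:M); congr (closed _).
apply/seteqP; split=> [_ [x Cx <-]|x Cx]; first by rewrite mul1mx.
by exists x; rewrite ?mul1mx.
Qed.

(** A subspace as the kernel of a matrix: the equations that let a flat section be
read off a linear image in [closed_images_flat]. *)
Lemma vspace_kermx (R : realType) (n : nat) (V : {vspace 'cV[R]_n}) :
  exists B : 'M[R]_n, forall v, (v \in V) = (B *m v == 0).
Proof.
pose F v := v - projv V v.
exists (\matrix_(i, j) F (delta_mx j 0) i 0) => v.
have -> : \matrix_(i, j) F (delta_mx j 0) i 0 *m v = F v.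
  have {2}-> : v = \sum_j v j 0 *: delta_mx j 0.
    rewrite {1}(matrix_sum_delta v); apply: eq_bigr => j _.
    by rewrite big_ord1.
  apply/colP => i; rewrite /F linear_sum -sumrB summxE mxE.
  by apply: eq_bigr => j _; rewrite mxE linearZ /= -scalerBr [RHS]mxE mulrC.
rewrite subr_eq0 eq_sym; apply/idP/eqP => [/projv_id//|<-]; exact: memv_proj.
Qed.

(** Stacking the equations [B x = B s] of the flat on top of [A] gives one linear
map; the image under [A] of the section is the slice of its closed image above
the value [B s]. *)
Lemma closed_images_flat (R : realType) (n : nat) (C : set 'cV[R]_n)
    (V : {vspace 'cV[R]_n}) (s : 'cV[R]_n) :
  closed_images C -> closed_images (C `&` [set x | x - s \in V]).
Proof.
move=> hC m A; have [B BV] := vspace_kermx V.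
have cB : continuous (fun z : 'cV[R]_m => col_mx (B *m s) z).
  move=> x U /nbhs_ballP[e /= e0 eU]; apply/nbhs_ballP; exists e => //= y [_ xy].
  apply: eU; split=> // i j; rewrite !mxE.
  by case: (fintype.split i) => k; [exact: ballxx|exact: xy].
have := closed_comp (fun z _ => cB z) (hC _ (col_mx B A)).
congr (closed _); apply/seteqP; split=> [z [x Cx]|_ [x [Cx xs] <-]] /=.
  rewrite mul_col_mx => /eq_col_mx [Bx <-]; exists x => //; split=> //=.
  by rewrite BV mulmxBr Bx subrr.
exists x => //; rewrite mul_col_mx; congr col_mx.
by apply/eqP; rewrite -subr_eq0 -mulmxBr -BV.
Qed.

(** * Directions of recession *)

(** Transposition carries over the Heine-Borel theorem for row vectors. *)
Lemma bounded_closed_compact_cV (R : realType) (n : nat) (A : set 'cV[R]_n) :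
  bounded_set A -> closed A -> compact A.
Proof.
move=> bA cA.
have ctr p q : continuous (trmx : 'M[R]_(p, q) -> 'M[R]_(q, p)).
  move=> x U /nbhs_ballP[e /= e0 eU]; apply/nbhs_ballP; exists e => //= y [_ xy].
  by apply: eU; split=> // i j; rewrite !mxE; exact: xy.
have -> : A = trmx @` (trmx @^-1` A : set 'rV[R]_n).
  apply/seteqP; split=> [x Ax|_ [x Ax <-]//].
  by exists x^T; rewrite /= trmxK.
apply: continuous_compact; first by apply: continuous_subspaceT; exact: ctr.
apply: bounded_closed_compact; last exact: closed_comp (fun x _ => ctr _ _ x) cA.
have [M [Mr hM]] := bA; exists M; split=> // r Mr' x /= /hM => /(_ r Mr').
apply: le_trans; rewrite [leLHS]/Num.norm [leRHS]/Num.norm /= !mx_normrE.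
apply/bigmax_leP; split=> [|[i j] _ /=]; first by apply: bigmax_ge_id.
by apply/bigmax_geP; right; exists (j, i); rewrite ?mxE.
Qed.

Lemma closed_segment_end (R : realType) (n : nat) (S : set 'cV[R]_n)
    (z w : 'cV[R]_n) : closed S ->
  (forall e, 0 < e -> e <= 1 -> S (z + e *: w)) -> S z.
Proof.
move=> clS Se; apply: clS => U /nbhs_ballP[r /= r0 rU].
have D0 : 0 < 1 + `|w| + r by have := normr_ge0 w; lra.
have De : r / (1 + `|w| + r) <= 1.
  by rewrite ler_pdivrMr// mul1r; have := normr_ge0 w; lra.
exists (z + (r / (1 + `|w| + r)) *: w); split; first by apply: Se; rewrite ?divr_gt0.
apply: rU; rewrite -ball_normE /ball_ /= opprD addrA subrr add0r normrN normrZ.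
rewrite gtr0_norm ?divr_gt0// mulrAC ltr_pdivrMr// ltr_pM2l//; lra.
Qed.

(** The segment from [x] to the far point [s + (t / e) d] passes within
[e |s - x|] of [x + t d]. *)
Lemma recession_transfer (R : realType) (n : nat) (S : set 'cV[R]_n)
    (s d x : 'cV[R]_n) : closed S -> @convex_set R 'cV[R]_n S ->
  (forall t, 0 <= t -> S (s + t *: d)) -> S x ->
  forall t, 0 <= t -> S (x + t *: d).
Proof.
move=> clS /convex_setE cS Sd Sx t t0.
apply: (@closed_segment_end _ _ _ _ (s - x) clS) => e e0 e1.
have -> : x + t *: d + e *: (s - x) = x + e *: (s + (t / e) *: d - x).
  apply/colP => i; rewrite !mxE; field; exact: lt0r_neq0.
by apply: cS => //; [apply: Sd; rewrite divr_ge0// ltW|exact: ltW].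
Qed.

(** A limit [d] of normalised points [u_k / |u_k|] of [S] with [|u_k|] tending to
infinity: [x + t d] is a limit of points of the segments from [x] to [u_k]. *)
Lemma recession_direction (R : realType) (n : nat) (S : set 'cV[R]_n) :
  closed S -> @convex_set R 'cV[R]_n S -> ~ bounded_set S ->
  exists2 d, d != 0 & forall x t, S x -> 0 <= t -> S (x + t *: d).
Proof.
move=> clS /convex_setE cS nb.
have far (k : nat) : exists x, S x /\ k%:R < `|x|.
  apply: contrapT => nx; apply: nb; exists k%:R; split=> // r kr x Sx.
  apply: le_trans (ltW kr); rewrite leNgt; apply/negP => kx.
  by apply: nx; exists x.
have [u uP] := choice far.
pose d_ k := `|u k|^-1 *: u k.
have u_gt0 k : 0 < `|u k| by case: (uP k) => _; apply: le_lt_trans.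
pose K := [set v : 'cV[R]_n | `|v| = 1].
have cK : compact K.
  apply: bounded_closed_compact_cV.
    by exists 1; split=> // r r1 v /= ->; exact: ltW.
  apply: (closed_comp (fun v _ => @norm_continuous R _ v) (@closed_eq R 1)).
have FK : (d_ @ \oo) K.
  by exists 0%N => // k _; rewrite /K /= /d_ normrZ normfV normr_id mulVf// lt0r_neq0.
have [d [/= d1 cd]] := cK _ _ FK.
exists d => [|x t Sx t0]; first by rewrite -normr_gt0 d1.
apply: clS => U /nbhs_ballP[e /= e0 eU].
have [N N1] : exists N : nat, t + t * `|x| * 2 / e <= N%:R.
  by exists (Num.truncn (t + t * `|x| * 2 / e)).+1; apply/ltW/truncnS_gt.
have tailN : (d_ @ \oo) [set d_ k | k in [set k | (N <= k)%N]].
  by exists N => // k /= Nk; exists k.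
(* [t + 1] instead of [t] keeps the radius finite when [t = 0]; the error splits
   into [t |d - d_ k|] and [t |x| / |u k|], each at most half of [e]. *)
have r0 : 0 < e / (2 * (t + 1)) by rewrite divr_gt0// mulr_gt0//; lra.
have [_ [[k /= Nk <-]]] := cd _ _ tailN (nbhsx_ballx d _ r0).
rewrite -ball_normE /ball_ /= => dk.
have [Suk uk] := uP k.
have Nu : t + t * `|x| * 2 / e < `|u k|.
  by apply: le_lt_trans N1 (le_lt_trans _ uk); rewrite ler_nat.
have tx0 : 0 <= t * `|x| * 2 / e by rewrite divr_ge0 ?(ltW e0)// !mulr_ge0.
exists (x + (t / `|u k|) *: (u k - x)); split.
  apply: cS => //; first by rewrite divr_ge0// ltW.
  by rewrite ler_pdivrMr// mul1r; lra.
apply: eU; rewrite -ball_normE /ball_ /=.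
have -> : x + t *: d - (x + (t / `|u k|) *: (u k - x)) =
    t *: (d - d_ k) + (t / `|u k|) *: x.
  by rewrite /d_; apply/colP => i; rewrite !mxE; ring.
apply: le_lt_trans (ler_normD _ _) _; rewrite 2!normrZ.
have tu0 : 0 <= t / `|u k| by rewrite divr_ge0// ltW.
rewrite (ger0_norm t0) (ger0_norm tu0).
have h1 : t * `|d - d_ k| <= e / 2.
  have : t * `|d - d_ k| <= t * (e / (2 * (t + 1))) by rewrite ler_wpM2l// ltW.
  move/le_trans; apply; rewrite mulrA ler_pdivrMr; last by lra.
  nra.
have h2 : t / `|u k| * `|x| < e / 2.
  rewrite mulrAC ltr_pdivrMr//.
  have : t * `|x| * 2 / e < `|u k| by lra.
  rewrite ltr_pdivrMr//; lra.
lra.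
Qed.

(** * Affine hulls and convex polynomials *)

(** A polynomial vanishing on a convex set vanishes on its affine hull, whose points
have the form [s + a (y - x)].  The line through such a point need not meet [S] in
a segment, but the parallel line through a point [s + r (x - s)] with
[0 < r <= 1] does; then let [r] vary along a second line and take [r = 0]. *)
Lemma poly_on_lines_eq0 (R : realType) (n : nat) (F : 'cV[R]_n -> R)
    (S : set 'cV[R]_n) (s x y : 'cV[R]_n) (a : R) :
  poly_on_lines F -> @convex_set R 'cV[R]_n S -> (forall z, S z -> F z = 0) ->
  S s -> S x -> S y -> F (s + a *: (y - x)) = 0.
Proof.
move=> FL /convex_setE cS F0 Ss Sx Sy.
have Fr r : 0 < r -> r <= 1 -> F (s + a *: (y - x) + r *: (x - s)) = 0.
  move=> r0 r1; have [p Fp] := FL (s + r *: (x - s)) (y - x).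
  have p0 : p = 0.
    apply: (horner_eq0_itv r0) => t t0 tr; rewrite -Fp; apply: F0.
    have -> : s + r *: (x - s) + t *: (y - x) =
        s + r *: (x + (t / r) *: (y - x) - s).
      by apply/colP => i; rewrite !mxE; field; exact: lt0r_neq0.
    apply: (cS s _ r) => //; last exact: ltW.
    apply: cS => //; first by rewrite divr_ge0// ltW.
    by rewrite ler_pdivrMr// mul1r.
  by rewrite addrAC Fp p0 horner0.
have [q Fq] := FL (s + a *: (y - x)) (x - s).
have q0 : q = 0.
  by apply: (horner_eq0_itv ltr01) => r r0 r1; rewrite -Fq Fr.
by have := Fq 0; rewrite scale0r addr0 q0 horner0.
Qed.

(** Adjoin elements of [T] to a subspace contained in it until the dimension stops
growing. *)
Lemma vspace_of_linear_closed (R : realType) (n : nat) (T : set 'cV[R]_n) :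
  T 0 -> (forall a u v, T u -> T v -> T (a *: u + v)) ->
  exists V : {vspace 'cV[R]_n}, forall v, v \in V <-> T v.
Proof.
move=> T0 TL.
suff grow k (U : {vspace 'cV[R]_n}) : (\dim {:'cV[R]_n} - \dim U <= k)%N ->
    (forall v, v \in U -> T v) ->
    exists V : {vspace 'cV[R]_n}, forall v, v \in V <-> T v.
  by apply: (grow _ 0%VS (leqnn _)) => v; rewrite memv0 => /eqP ->.
elim: k U => [|k IH] U dU UT.
  have UE : U = fullv.
    apply/eqP; rewrite eqEdim subvf /=.
    by move: dU; rewrite leqn0 subn_eq0.
  by exists U => v; split=> [/UT//|_]; rewrite UE memvf.
have [TU|/existsNP[v /not_implyP[Tv /negP vU]]] :=
  pselect (forall v, T v -> v \in U); first by exists U => v; split=> [/UT|/TU].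
apply: (IH (U + <[v]>)%VS).
  have dUv : (\dim U < \dim (U + <[v]>))%N.
    rewrite ltnNge; apply: contra vU => le.
    have /eqP UE : U == (U + <[v]>)%VS by rewrite eqEdim addvSl.
    by rewrite UE memvE addvSr.
  rewrite -ltnS; apply: leq_trans dU; rewrite ltn_sub2l//.
  by rewrite (leq_trans dUv)// dimvS// subvf.
move=> _ /memv_addP[u uU [_ /vlineP[a ->] ->]].
by rewrite addrC; apply: TL => //; exact: UT.
Qed.

(** The cone over the differences of a convex set is closed under addition, since
[a (y - x) + b (y' - x')] is [a + b] times the difference of two convex
combinations; it is symmetric, so it is already the span. *)
Lemma span_convex (R : realType) (n : nat) (S : set 'cV[R]_n) :
  S !=set0 -> @convex_set R 'cV[R]_n S ->
  exists V : {vspace 'cV[R]_n}, forall v, v \in V <->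
    exists x y a, [/\ S x, S y & v = a *: (y - x)].
Proof.
move=> [s Ss] /convex_setE cS.
pose T v := exists x y a, [/\ S x, S y, 0 <= a & v = a *: (y - x)].
have TZ a v : T v -> T (a *: v).
  move=> [x [y [b [Sx Sy b0 ->]]]]; have [a0|a0] := lerP 0 a.
    by exists x, y, (a * b); rewrite mulr_ge0 // scalerA.
  exists y, x, (- a * b); split=> //; first by rewrite mulr_ge0// oppr_ge0 ltW.
  by rewrite scalerA mulNr scaleNr -scalerN opprB.
have TD u v : T u -> T v -> T (u + v).
  move=> [x [y [a [Sx Sy a0 ->]]]] [x' [y' [b [Sx' Sy' b0 ->]]]].
  have [->|b_neq0] := eqVneq b 0; first by exists x, y, a; rewrite scale0r addr0.
  have bp : 0 < b by rewrite lt0r b_neq0.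
  have ab0 : 0 < a + b by lra.
  have l0 : 0 <= b / (a + b) by rewrite divr_ge0// ltW.
  have l1 : b / (a + b) <= 1 by rewrite ler_pdivrMr// mul1r; lra.
  exists (x + (b / (a + b)) *: (x' - x)), (y + (b / (a + b)) *: (y' - y)), (a + b).
  split; [exact: cS|exact: cS|exact: ltW|].
  by apply/colP => i; rewrite !mxE; field; exact: lt0r_neq0.
have [||V VT] := @vspace_of_linear_closed R n T.
- by exists s, s, 0; rewrite scale0r.
- by move=> a u v Tu Tv; apply: TD => //; exact: TZ.
exists V => v; rewrite VT; split=> [[x [y [a [Sx Sy _ ->]]]]|].
  by exists x, y, a.
move=> [x [y [a [Sx Sy ->]]]]; apply: TZ; exists x, y, 1; split => //.
by rewrite scale1r.
Qed.

Lemma convex_affine_along (R : realType) (n : nat) (C : set 'cV[R]_n)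
    (g : 'cV[R]_n -> R) (s d : 'cV[R]_n) (M : R) :
  poly_on_lines g -> @convex_function R 'cV[R]_n C g ->
  (forall t, 0 <= t -> C (s + t *: d)) ->
  (forall t, 0 <= t -> g (s + t *: d) <= M) ->
  exists2 c, c <= 0 & forall t, g (s + t *: d) = g s + c * t.
Proof.
move=> gL /convex_functionE cg Cd gM.
have [p gp] := gL s d.
have p0 : p.[0] = g s by rewrite -gp scale0r addr0.
have [||c c0 pc] := @convex_poly_affine R p M.
- by move=> t t0; rewrite -gp; exact: gM.
- move=> t t1; have t0 : 0 < t by apply: lt_le_trans t1.
  rewrite p0 -!gp mulrC -ler_pdivlMr// lerBlDl mulrC.
  have := cg s (s + t *: d) t^-1.
  have -> : s + t^-1 *: (s + t *: d - s) = s + 1 *: d.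
    by apply/colP => i; rewrite !mxE; field; exact: lt0r_neq0.
  apply.
  + by have := Cd 0 (lexx _); rewrite scale0r addr0.
  + exact/Cd/ltW.
  + by rewrite invr_ge0 ltW.
  + by rewrite invf_le1.
by exists c => // t; rewrite gp pc p0.
Qed.

(** Points on the segment from [x] to [s + (t / e) d] approach [x + t d] as [e]
tends to [0], and convexity bounds [g] there by [g x + c t + O(e)]. *)
Lemma convex_slope_le (R : realType) (n : nat) (C : set 'cV[R]_n)
    (g : 'cV[R]_n -> R) (s x d : 'cV[R]_n) (c : R) :
  poly_on_lines g -> @convex_function R 'cV[R]_n C g -> C x ->
  (forall t, 0 <= t -> C (s + t *: d)) ->
  (forall t, g (s + t *: d) = g s + c * t) ->
  forall t, 0 <= t -> g (x + t *: d) <= g x + c * t.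
Proof.
move=> gL /convex_functionE cg Cx Cd gc t t0.
have [p gp] := gL (x + t *: d) (s - x).
pose q := (g x + c * t)%:P + (g s - g x)%:P * 'X - p.
have : 0 <= q.[0].
  apply: horner_ge0_at0 => e e0 e1; rewrite !hornerE -gp.
  have -> : x + t *: d + e *: (s - x) = x + e *: (s + (t / e) *: d - x).
    by apply/colP => i; rewrite !mxE; field; exact: lt0r_neq0.
  have te0 : 0 <= t / e by rewrite divr_ge0// ltW.
  have := cg x _ e Cx (Cd _ te0) (ltW e0) e1; rewrite gc.
  have -> : g x + e * (g s + c * (t / e) - g x) = g x + c * t + (g s - g x) * e.
    by field; exact: lt0r_neq0.
  by rewrite subr_ge0.
by rewrite !hornerE -gp scale0r !addr0 subr_ge0.
Qed.

(** [convex_slope_le] makes [g] bounded above along [d] from every point of [C],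
hence affine there, and applying it in both directions equates the slopes. *)
Lemma convex_common_slope (R : realType) (n : nat) (C : set 'cV[R]_n)
    (g : 'cV[R]_n -> R) (s d : 'cV[R]_n) (M : R) :
  poly_on_lines g -> @convex_function R 'cV[R]_n C g ->
  (forall x t, C x -> 0 <= t -> C (x + t *: d)) ->
  C s -> (forall t, 0 <= t -> g (s + t *: d) <= M) ->
  exists2 c, c <= 0 & forall x t, C x -> g (x + t *: d) = g x + c * t.
Proof.
move=> gL cg Cd Cs gM.
have [c c0 gc] := convex_affine_along gL cg (fun t => Cd s t Cs) gM.
exists c => // x t Cx.
have gx u : 0 <= u -> g (x + u *: d) <= g x.
  move=> u0; have := convex_slope_le gL cg Cx (fun t => Cd s t Cs) gc u0.
  by move/le_trans; apply; rewrite gerDl mulr_le0_ge0.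
have [c' c'0 gc'] := convex_affine_along gL cg (fun t => Cd x t Cx) gx.
suff -> : c = c' by [].
have := convex_slope_le gL cg Cx (fun t => Cd s t Cs) gc ler01.
have := convex_slope_le gL cg Cs (fun t => Cd x t Cx) gc' ler01.
by rewrite gc gc' !mulr1 !lerD2l => ? ?; apply/eqP; rewrite eq_le; apply/andP.
Qed.

(** The orthogonal projection along [d]. *)
Lemma line_projection (R : realType) (n : nat) (d : 'cV[R]_n) : d != 0 ->
  exists2 P : 'M[R]_n, P *m d = 0 & forall x, exists a, P *m x = x + a *: d.
Proof.
move=> d0; pose c := (d^T *m d) 0 0.
have c0 : c != 0 by apply: contra d0 => /eqP /sqnorm_eq0 ->.
have PE x : (1%:M - c^-1 *: (d *m d^T)) *m x = x - (c^-1 * (d^T *m x) 0 0) *: d.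
  rewrite mulmxBl mul1mx -scalemxAl -mulmxA -scalerA; congr (_ - _ *: _).
  by rewrite {1}[d^T *m x]mx11_scalar mul_mx_scalar.
exists (1%:M - c^-1 *: (d *m d^T)) => [|x].
  by rewrite PE mulVf// scale1r subrr.
by exists (- (c^-1 * (d^T *m x) 0 0)); rewrite PE scaleNr.
Qed.

(** * Minimisation by projecting out directions of recession *)

(** The set [J] of active constraints varies because some of them disappear under
projection. *)
Definition feasible (R : realType) (n m : nat) (h : 'I_m -> 'cV[R]_n -> R)
    (f : 'cV[R]_n -> R) (alpha : R) (C : set 'cV[R]_n) (J : set 'I_m) :
    set 'cV[R]_n :=
  [set x | [/\ C x, forall i, J i -> h i x <= 0 & f x <= alpha]].

Lemma closed_feasible (R : realType) (n m : nat) (h : 'I_m -> 'cV[R]_n -> R)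
    (f : 'cV[R]_n -> R) (alpha : R) (C : set 'cV[R]_n) (J : set 'I_m) :
  (forall i, polynomial_fun (h i)) -> polynomial_fun f -> closed C ->
  closed (feasible h f alpha C J).
Proof.
move=> hp fp clC.
have le_closed g a : polynomial_fun g -> closed [set x : 'cV[R]_n | g x <= a].
  move=> gp; apply: (closed_comp _ (@closed_le R a)) => x _.
  exact: polynomial_fun_continuous.
have -> : feasible h f alpha C J =
    C `&` (\bigcap_(i in J) [set x | h i x <= 0]) `&` [set x | f x <= alpha].
  by apply/seteqP; split=> [x []|x [[]]].
apply: closedI; last exact: le_closed.
by apply: closedI => //; apply: closed_bigI => i _; exact: le_closed.
Qed.

(** Induction on the dimension of a subspace [V] containing the differences of
points of the feasible set.  The ambient space, [f] and [h] never change: a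
projection replaces [C] by an image in the same space and may shrink [J]. *)
Lemma feasible_attains_min (R : realType) (n m : nat)
    (h : 'I_m -> 'cV[R]_n -> R) (f : 'cV[R]_n -> R) (alpha l : R)
    (C : set 'cV[R]_n) (J : set 'I_m) :
  (forall i, polynomial_fun (h i)) -> polynomial_fun f ->
  closed_images C -> @convex_set R 'cV[R]_n C ->
  (forall i, J i -> @convex_function R 'cV[R]_n C (h i)) ->
  feasible h f alpha C J !=set0 ->
  @convex_set R 'cV[R]_n (feasible h f alpha C J) ->
  (forall x, feasible h f alpha C J x -> l <= f x) ->
  exists2 x, feasible h f alpha C J x &
    forall y, feasible h f alpha C J y -> f x <= f y.
Proof.
move=> hp fp.
suff main k (V : {vspace 'cV[R]_n}) : (\dim V < k)%N ->
    forall C J, closed_images C -> @convex_set R 'cV[R]_n C ->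
    (forall i, J i -> @convex_function R 'cV[R]_n C (h i)) ->
    feasible h f alpha C J !=set0 ->
    @convex_set R 'cV[R]_n (feasible h f alpha C J) ->
    (forall x y, feasible h f alpha C J x -> feasible h f alpha C J y ->
      y - x \in V) ->
    (forall x, feasible h f alpha C J x -> l <= f x) ->
    exists2 x, feasible h f alpha C J x &
      forall y, feasible h f alpha C J y -> f x <= f y.
  move=> clC cC ch S0 cS fl.
  by apply: (main _ fullv (ltnSn _)) => // x y _ _; exact: memvf.
elim: k V {C J} => [//|k IH] V dV C J clC cC ch S0 cS SV fl.
set S := feasible h f alpha C J in S0 cS SV fl *.
have clS : closed S by apply: closed_feasible => //; exact: closed_images_closed.
have [bS|nbS] := pselect (bounded_set S).
  have [||x xS xmin] := @compact_EVT_min _ R f S S0.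
  - exact: bounded_closed_compact_cV.
  - by apply: continuous_subspaceT; exact: polynomial_fun_continuous.
  by exists x => [|y Sy]; [rewrite -inE|apply: xmin; rewrite inE].
have [d d0 Sd] := recession_direction clS cS nbS.
have [s Ss] := S0.
have [V1 V1E] := span_convex S0 cS.
have dV1 : d \in V1.
  apply/V1E; exists s, (s + 1 *: d), 1; split=> //; first exact: Sd.
  by rewrite !scale1r addrAC subrr add0r.
have V1V : (V1 <= V)%VS.
  by apply/subvP => v /V1E[x [y [a [Sx Sy ->]]]]; rewrite memvZ// SV.
have fL := polynomial_fun_lines fp.
(* Along [d] from a point of [S], [f] lies between [l] and [alpha]. *)
have fS x t : S x -> f (x + t *: d) = f x.
  move=> Sx; have [p pE] := fL x d.
  rewrite pE (@horner_const_of_bounded _ _ (`|l| + `|alpha|)); last first.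
    move=> u u0; rewrite -pE.
    have Sxu := Sd _ _ Sx u0.
    have lu := fl _ Sxu; have [_ _ au] := Sxu.
    have := ler_norm alpha; have := normr_ge0 alpha; have := normr_ge0 l.
    have : - `|l| <= l by rewrite lerNnormlW.
    by move=> *; rewrite ler_norml; apply/andP; split; lra.
  by rewrite -pE scale0r addr0.
have fconst x t : x - s \in V1 -> f (x + t *: d) = f x.
  move=> /V1E[y [z [a [Sy Sz xs]]]].
  have -> : x = s + a *: (z - y) by rewrite -xs addrC subrK.
  apply/eqP; rewrite -subr_eq0; apply/eqP.
  pose F x := f (x + t *: d) - f x.
  apply: (@poly_on_lines_eq0 _ _ F S) => // [u v|u Su]; last first.
    by rewrite /F fS// subrr.
  have [p pE] := fL (u + t *: d) v; have [q qE] := fL u v.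
  by exists (p - q) => r; rewrite hornerD hornerN -pE -qE /F addrAC.
have Cd x t : C x -> 0 <= t -> C (x + t *: d).
  move=> Cx; apply: (@recession_transfer _ _ C s) => //.
    exact: closed_images_closed.
  by move=> u u0; have [] := Sd _ _ Ss u0.
have /choice[c cP] : forall i, exists c : R, J i -> c <= 0 /\
    forall x t, C x -> h i (x + t *: d) = h i x + c * t.
  move=> i.
  have [Ji|nJi] := pselect (J i); last by exists 0.
  have [|||e e0 he] := @convex_common_slope _ _ C (h i) s d 0 _ (ch i Ji) Cd.
  - exact: polynomial_fun_lines.
  - by case: Ss.
  - by move=> t t0; have [_ + _] := Sd _ _ Ss t0; exact.
  by exists e.
have [P Pd PE] := line_projection d0.
pose C1 := C `&` [set x | x - s \in V1].
pose C' := [set P *m x | x in C1].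
pose J' := [set i | J i /\ c i = 0].
have fP x : x - s \in V1 -> f (P *m x) = f x.
  by move=> xs; have [a ->] := PE x; exact: fconst.
have hP i x : J' i -> C x -> h i (P *m x) = h i x.
  by move=> [Ji ci] Cx; have [a ->] := PE x; rewrite (cP i Ji).2// ci mul0r addr0.
have SL x : S x -> x - s \in V1.
  by move=> Sx; apply/V1E; exists s, x, 1; rewrite scale1r.
have S'E : feasible h f alpha C' J' = [set P *m x | x in S].
  apply/seteqP; split=> [_ [[x [Cx xs] <-] hx fx]|_ [x Sx <-]]; last first.
    have [Cx hx fx] := Sx; split; first by exists x => //; split=> //; exact: SL.
      by move=> i J'i; rewrite hP//; apply: hx; case: J'i.
    by rewrite fP//; exact: SL.
  (* A step long enough to satisfy every constraint of negative slope; division by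
     a zero slope contributes nothing. *)
  pose t := \sum_i `|h i x / c i|.
  have t0 : 0 <= t by apply: sumr_ge0.
  exists (x + t *: d); last by rewrite mulmxDr -scalemxAr Pd scaler0 addr0.
  split; first exact: Cd.
    move=> i Ji; have [ci0 hi] := cP i Ji; rewrite hi//.
    have [ci|ci] := eqVneq (c i) 0.
      by rewrite ci mul0r addr0 -(hP i)//; apply: hx.
    have ti : `|h i x / c i| <= t.
      by rewrite /t (bigD1 i)//= lerDl sumr_ge0.
    have cn : c i < 0 by rewrite lt_neqAle ci.
    have : c i * t <= c i * `|h i x / c i| by rewrite ler_wnM2l.
    have : c i * `|h i x / c i| <= c i * - (h i x / c i).
      by rewrite ler_wnM2l// -normrN ler_norm.
    rewrite mulrN mulrCA divff// mulr1; lra.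
  by rewrite fconst// -fP.
have C1L x y a : C1 x -> C1 y -> 0 <= a -> a <= 1 -> C1 (x + a *: (y - x)).
  move=> [Cx xs] [Cy ys] a0 a1; split.
    by have /convex_setE := cC; apply.
  rewrite /= addrAC memvD// memvZ//.
  by have -> : y - x = y - s - (x - s); [rewrite opprB addrA subrK|rewrite memvB].
have PL x y a : P *m x + a *: (P *m y - P *m x) = P *m (x + a *: (y - x)).
  by rewrite mulmxDr -scalemxAr mulmxBr.
(* The kernel of [P] meets [V1] in [d], so the dimension drops. *)
have dimV' : (\dim (linfun (mulmx P : 'cV[R]_n -> 'cV[R]_n) @: V1) < k)%N.
  have := limg_ker_dim (linfun (mulmx P : 'cV[R]_n -> 'cV[R]_n)) V1.
  have : (0 < \dim (V1 :&: lker (linfun (mulmx P : 'cV[R]_n -> 'cV[R]_n))))%N.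
    rewrite lt0n dimv_eq0; apply: contraNneq d0 => V0.
    by rewrite -memv0 -V0 memv_cap dV1 memv_ker lfunE /= Pd.
  move=> ker_gt0 dimE; rewrite -ltnS; apply: leq_trans dV.
  rewrite ltnS; apply: leq_trans (dimvS V1V).
  by rewrite -dimE -[X in (X < _)%N]add0n ltn_add2r.
have [|||||||z] := IH _ dimV' C' J'.
- exact/closed_images_image/closed_images_flat.
- apply/convex_setE => _ _ a [x C1x <-] [y C1y <-] a0 a1.
  by rewrite PL; exists (x + a *: (y - x)) => //; exact: C1L.
- move=> i J'i; apply/convex_functionE => _ _ a [x C1x <-] [y C1y <-] a0 a1.
  have [Cx _] := C1x; have [Cy _] := C1y; have [Cxy _] := C1L _ _ _ C1x C1y a0 a1.
  rewrite PL !hP//.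
  by have /convex_functionE := ch i J'i.1; apply.
- by exists (P *m s); rewrite S'E; exists s.
- rewrite S'E; apply/convex_setE => _ _ a [x Sx <-] [y Sy <-] a0 a1.
  rewrite PL; exists (x + a *: (y - x)) => //.
  by have /convex_setE := cS; apply.
- rewrite S'E => _ _ [x Sx <-] [y Sy <-].
  rewrite -mulmxBr; apply/memv_imgP; exists (y - x); last by rewrite lfunE.
  by apply/V1E; exists x, y, 1; rewrite scale1r.
- by rewrite S'E => _ [x Sx <-]; rewrite fP; [exact: fl|exact: SL].
rewrite S'E => -[x Sx <-] xmin; exists x => // y Sy.
rewrite -(fP x); last exact: SL.
by rewrite -(fP y); [apply: xmin; exists y|exact: SL].
Qed.

Theorem corollary3 (R : realType) (n m : nat) (F0 : set 'cV[R]_n)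
  (g : 'I_m -> 'cV[R]_n -> R) (f : 'cV[R]_n -> R) :
  qFW_set F0 ->
  (forall i, polynomial_fun (g i)) ->
  (forall i, @convex_function R 'cV[R]_n F0 (g i)) ->
  constrained F0 g !=set0 ->
  polynomial_fun f ->
  bounded_below_on (constrained F0 g) f ->
  (exists alpha : R, sublevel f (constrained F0 g) alpha !=set0 /\
     @convex_set R 'cV[R]_n (sublevel f (constrained F0 g) alpha)) ->
  attains_inf_on (constrained F0 g) f.
Proof.
move=> qFW gp gc _ fp [l fl] [alpha [S0 cS]].
have SE : sublevel f (constrained F0 g) alpha = feasible g f alpha F0 setT.
  apply/seteqP; split=> [x [[F0x gx] fx]|x [F0x gx fx]]; split=> //.
  by split=> // i; exact: gx.
rewrite SE in S0 cS.
have [x [F0x gx fx] xmin] : exists2 x, feasible g f alpha F0 setT x &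
    forall y, feasible g f alpha F0 setT y -> f x <= f y.
  apply: (@feasible_attains_min _ _ _ _ _ _ l) => //.
  - exact: qFW_closed_images.
  - by case: qFW.
  - move=> x [F0x gx _]; apply: fl; exists x => //; split=> // i; exact: gx.
have Fx : constrained F0 g x by split=> // i; exact: gx.
exists x => //; apply/eqP; rewrite eq_le; apply/andP; split; last first.
  by apply: ereal_inf_lbound; exists x.
apply: le_ereal_inf_tmp => _ [y [F0y gy] <-]; rewrite lee_fin.
have [fya|/ltW] := leP (f y) alpha; last exact: le_trans.
by apply: xmin; split.
Qed.
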